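(* Let $\mathcal{B}$ be the set of all connected graphs in which every block is a complete graph of odd order. If $G$ is a connected graph of odd order $n\ge 3$, then $G$ contains a proper $1$-perfect forest if and only if $G\notin\mathcal{B}$.
   Context: All graphs are finite and undirected, with no parallel edges or loops. The order of a graph is its number of vertices. A vertex $x$ of a graph $G$ is a cut-vertex if $G-x$ has more connected components than $G$. A block of $G$ is a maximal connected subgraph of $G$ without a cut-vertex (of itself); thus every block is either a maximal 2-connected subgraph, or a bridge (including its vertices), or an isolated vertex. A $1$-perfect forest of $G$ is a spanning forest $F$ of $G$ such that every tree (connected component) of $F$ is an induced subgraph of $G$ and exactly one vertex has even degree (possibly zero) in $F$, all other vertices having odd degree in $F$. A $1$-perfect forest is proper if it has no vertices of degree zero. *)

(* Defs.v *)
From mathcomp Require Import all_boot.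

Set Implicit Arguments.
Unset Strict Implicit.
Unset Printing Implicit Defensive.

(* The vertex set is a subset of an ambient finite type, so that a graph and
   all its subgraphs have the same type. *)
Record sgraph (T : finType) := SGraph {
  vertices : {set T};
  adj : rel T;
  adj_sym : symmetric adj;
  adj_irrefl : irreflexive adj;
  adj_vertices : forall x y, adj x y -> x \in vertices
}.

Section Graphs.
Variable T : finType.
Implicit Types (G H F : sgraph T) (A : {set T}) (x y : T).

Definition order_of G : nat := #|vertices G|.

Definition degree G x : nat := #|[set y | adj G x y]|.

Definition subgraph H G : Prop :=
  vertices H \subset vertices G /\ subrel (adj H) (adj G).

Definition induced_subgraph H G : Prop :=
  subgraph H G /\
  forall x y, x \in vertices H -> y \in vertices H -> adj G x y -> adj H x y.

Definition induce_adj G A : rel T :=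
  fun x y => [&& x \in A, y \in A & adj G x y].

Fact induce_sym G A : symmetric (induce_adj G A).
Proof. by move=> x y; rewrite /induce_adj adj_sym andbCA. Qed.

Fact induce_irrefl G A : irreflexive (induce_adj G A).
Proof. by move=> x; rewrite /induce_adj adj_irrefl !andbF. Qed.

Fact induce_vertices G A x y :
  induce_adj G A x y -> x \in vertices G :&: A.
Proof. by case/and3P=> xA _ /adj_vertices xG; rewrite inE xG. Qed.

Definition induce G A : sgraph T :=
  SGraph (@induce_sym G A) (@induce_irrefl G A) (@induce_vertices G A).

Definition delete_vertex G x : sgraph T := induce G [set~ x].

(* The null graph does not count as connected. *)
Definition connected G : Prop :=
  vertices G != set0 /\
  {in vertices G &, forall x y, connect (adj G) x y}.

Definition num_components G : nat := n_comp (adj G) (vertices G).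

Definition component G x : sgraph T :=
  induce G [set y | connect (adj G) x y].

Definition cut_vertex G x : Prop :=
  x \in vertices G /\ num_components G < num_components (delete_vertex G x).

Definition connected_without_cut_vertex G : Prop :=
  connected G /\ forall x, ~ cut_vertex G x.

Definition block H G : Prop :=
  [/\ subgraph H G, connected_without_cut_vertex H &
      forall H', subgraph H' G -> connected_without_cut_vertex H' ->
        subgraph H H' -> subgraph H' H].

Definition complete G : Prop :=
  {in vertices G &, forall x y, x != y -> adj G x y}.

Definition odd_complete_blocks G : Prop :=
  connected G /\ forall H, block H G -> complete H /\ odd (order_of H).

(* [ucycle] also accepts the sequence [:: x; y] when x and y are adjacent, so
   genuine cycles are those with at least three vertices. *)
Definition forest F : Prop :=
  forall c : seq T, ucycle (adj F) c -> size c <= 2.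

Definition spanning_forest F G : Prop :=
  [/\ subgraph F G, vertices F = vertices G & forest F].

Definition one_perfect_forest F G : Prop :=
  [/\ spanning_forest F G,
      forall x, x \in vertices F -> induced_subgraph (component F x) G &
      #|[set x in vertices F | ~~ odd (degree F x)]| = 1].

Definition proper_one_perfect_forest F G : Prop :=
  one_perfect_forest F G /\ forall x, x \in vertices F -> degree F x != 0.

End Graphs.

(* Main.v *)
Require Import Defs.
From mathcomp Require Import all_boot.
From Stdlib Require Import Classical_Prop.

Set Implicit Arguments.
Unset Strict Implicit.
Unset Printing Implicit Defensive.

(** The proof rests on parity. Among all symmetric sets of edges of [G] with
    prescribed degree parities, one with fewest edges is an induced forest:
    if it joined the ends [u], [v] of an edge of [G] by a path other than that
    edge, exchanging the path for the edge (or dropping the whole cycle) would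
    keep all parities and lose edges. Sums of paths modulo 2 realize every set
    of parities with an even number of odd vertices. Hence a connected graph of
    odd order has, for every vertex [x], a forest with induced trees in which
    exactly [x] has even degree ([near_odd_exists]); such a forest is proper as
    soon as [x] is not isolated in it ([near_odd_proper]).

    Suppose that no 1-perfect forest is proper, so that [x] is isolated
    in each of these forests. Hanging [x] on a tree by one edge, possibly
    after cutting an edge of that tree, gives other forests of the same kind,
    and their even vertex must be isolated too. It follows that every neighbour
    of [x] lies in a tree that is a single edge, with both ends adjacent to
    [x] ([neighbour_lone_edge]); the role of [x] can then be shifted to any
    neighbour ([near_odd_shift]). Shifting along a path of [G - x] between two
    neighbours [y] and [z] of [x] shows that [y] and [z] are adjacent
    ([neighbours_adjacent]). This forces every block to be complete, and the
    forest edges match the vertices of a block other than [x] in pairs, so the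
    block is odd ([isolated_odd_complete_blocks]).

    Conversely, let all blocks be complete and odd. Two neighbours of
    [x] joined by a path of [G - x] lie with [x] on a cycle, hence in a block,
    and are adjacent ([clique_neighbours]); and each component of [G - x] is
    even ([even_separated]). If a proper 1-perfect forest had even vertex [x]
    and an edge [xy], let [C] be the component of [G - x] containing [y]. Then
    [y] is the only forest neighbour of [x] in [C], so the forest restricted to
    [C] and [x] has only odd degrees, on an odd number of vertices: this
    contradicts the handshake lemma ([no_proper_forest]). *)

(** * Relations on a finite type: connectivity and parity of degrees *)

Section Relations.
Variable T : finType.
Implicit Types (e f : rel T) (a b u v s t x : T).

(** Serves for contractions: [h] may send some edges to single vertices. *)
Lemma connect_map e f (h : T -> T) u v :
  (forall s t, e s t -> connect f (h s) (h t)) ->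
  connect e u v -> connect f (h u) (h v).
Proof.
move=> hom /connectP[p]; elim: p u => [|w p IHp] u /=; first by move=> _ ->.
by case/andP=> /hom uw /IHp wv /wv; apply: connect_trans.
Qed.

Lemma connect_stable e (P : pred T) u v :
  (forall s t, e s t -> P s -> P t) -> connect e u v -> P u -> P v.
Proof.
move=> stP /connectP[p]; elim: p u => [|w p IHp] u /=; first by move=> _ ->.
by case/andP=> uw /IHp wv /wv IH /(stP _ _ uw).
Qed.

Lemma connect_symm e u v : symmetric e -> connect e u v = connect e v u.
Proof. by move=> /sym_connect_sym ->. Qed.

Definition edge u v : rel T :=
  fun s t => (s == u) && (t == v) || (s == v) && (t == u).
Definition add_edge e u v : rel T := fun s t => e s t || edge u v s t.
Definition del_edge e u v : rel T := fun s t => e s t && ~~ edge u v s t.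

Lemma edge_sym u v : symmetric (edge u v).
Proof. by move=> s t; rewrite /edge orbC andbC [X in _ || X]andbC. Qed.

Lemma edgeC u v s t : edge u v s t = edge v u s t.
Proof. by rewrite /edge orbC. Qed.

Lemma edge_id u v : edge u v u v.
Proof. by rewrite /edge !eqxx. Qed.

Lemma edgeP e u v s t : symmetric e -> edge u v s t -> e s t = e u v.
Proof. by move=> sym /orP[] /andP[/eqP-> /eqP->]; last exact: sym. Qed.

Lemma add_sym e u v : symmetric e -> symmetric (add_edge e u v).
Proof. by move=> sym s t; rewrite /add_edge sym edge_sym. Qed.

Lemma del_sym e u v : symmetric e -> symmetric (del_edge e u v).
Proof. by move=> sym s t; rewrite /del_edge sym edge_sym. Qed.

Lemma del_sub e u v : subrel (del_edge e u v) e.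
Proof. by move=> s t /andP[]. Qed.

(** Degrees are only needed modulo 2, where toggling an edge acts additively. *)
Definition parity e s : bool := \big[addb/false]_t e s t.

Lemma odd_card e s : odd #|[set t | e s t]| = parity e s.
Proof.
rewrite -sum1dep_card big_mkcond (big_morph odd oddD (erefl _)).
by apply: eq_bigr => t _; case: (e s t).
Qed.

Lemma eq_parity e f s : e s =1 f s -> parity e s = parity f s.
Proof. by move=> ef; apply: eq_bigr => t _; rewrite ef. Qed.

Lemma parity_addb e f s :
  parity (fun s t => e s t (+) f s t) s = parity e s (+) parity f s.
Proof. exact: big_split. Qed.

Lemma parity_neighbour e s : parity e s -> exists t, e s t.
Proof.
case: (boolP [exists t, e s t]) => [/existsP //|/existsPn none].
by rewrite /parity big1 // => t _; apply/negbTE.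
Qed.

Lemma parity_pred1 s : \big[addb/false]_t (t == s) = true.
Proof. by rewrite (bigD1 s) //= eqxx big1 // => t /negbTE. Qed.

Lemma parity_edge u v s : u != v -> parity (edge u v) s = (s == u) (+) (s == v).
Proof.
move=> uv; rewrite /parity /edge.
case: (eqVneq s u) => [->|su]; rewrite ?(negbTE uv) /=.
  by under eq_bigr do rewrite orbF; rewrite parity_pred1.
by case: (s == v); rewrite /= ?parity_pred1 ?big1.
Qed.

Lemma parity_add e u v s : symmetric e -> u != v -> ~~ e u v ->
  parity (add_edge e u v) s = parity e s (+) ((s == u) (+) (s == v)).
Proof.
move=> sym uv nuv; rewrite -(parity_edge _ uv) -parity_addb.
apply: eq_parity => t; rewrite /add_edge; case: (boolP (edge u v s t)).
  by move/(edgeP sym)->; rewrite (negbTE nuv).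
by rewrite orbF addbF.
Qed.

Lemma parity_del e u v s : symmetric e -> u != v -> e u v ->
  parity (del_edge e u v) s = parity e s (+) ((s == u) (+) (s == v)).
Proof.
move=> sym uv euv; rewrite -(parity_edge _ uv) -parity_addb.
apply: eq_parity => t; rewrite /del_edge; case: (boolP (edge u v s t)).
  by move/(edgeP sym)->; rewrite euv.
by rewrite andbT addbF.
Qed.

(** Swapping the ends of an arc pairs off the arcs. *)
Lemma handshake e : symmetric e -> irreflexive e ->
  \big[addb/false]_s parity e s = false.
Proof.
move=> sym irr; rewrite pair_big /=.
pose below (p : T * T) := enum_rank p.1 < enum_rank p.2.
have swap p : below p || (p.1 == p.2) = ~~ below (p.2, p.1).
  rewrite /below /= -leqNgt [RHS]leq_eqVlt orbC.
  by rewrite -(inj_eq enum_rank_inj) -(inj_eq val_inj).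
pose S := \big[addb/false]_(p | below p) e p.1 p.2.
suff -> : \big[addb/false]_(p : T * T) e p.1 p.2 = S (+) S by rewrite addbb.
rewrite (bigID below) /=; congr addb.
rewrite (reindex (fun p : T * T => (p.2, p.1))) /=; last first.
  by exists (fun p : T * T => (p.2, p.1)) => [[u v]|[u v]] _.
rewrite /S big_mkcond [RHS]big_mkcond; apply: eq_bigr => p _ /=.
rewrite -swap sym; case: (below p) => //=.
by case: eqP => // ->; apply: irr.
Qed.

(** The sum of the degrees inside [A] is even, and has the parity of [#|A|]. *)
Lemma even_card_of_odd e (A : {set T}) : symmetric e -> irreflexive e ->
  (forall s, s \in A -> parity (fun s t => (t \in A) && e s t) s) ->
  ~~ odd #|A|.
Proof.
move=> sym irr oddA.
pose f s t := [&& s \in A, t \in A & e s t].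
have <- : \big[addb/false]_s parity f s = odd #|A|.
  rewrite -sum1_card (big_morph odd oddD (erefl _)) [RHS]big_mkcond.
  apply: eq_bigr => s _; case: (boolP (s \in A)) => [sA|sA] /=.
    rewrite -[RHS](oddA s sA); apply: eq_parity => t.
    by rewrite /f sA.
  by rewrite /parity big1 // => t _; rewrite /f (negbTE sA).
by rewrite handshake // => [s t|s]; rewrite /f ?irr ?andbF // sym andbCA.
Qed.

Lemma even_card_classes e (A : {set T}) : symmetric e ->
  (forall s, s \in A -> ~~ odd #|[set t in A | connect e s t]|) ->
  ~~ odd #|A|.
Proof.
move=> sym evenC.
have eqv : {in A & &, equivalence_rel (connect e)}.
  move=> s t w _ _ _; split=> [|st]; first exact: connect0.
  by apply/idP/idP; apply: connect_trans; rewrite // (connect_symm _ _ sym).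
have /card_partition -> := equivalence_partitionP eqv.
rewrite (big_morph odd oddD (erefl _)) big1 // => _ /imsetP[s sA ->].
exact/negbTE/evenC.
Qed.

(** * Joins with fewest edges *)

(** Each undirected edge is counted twice. *)
Definition num_arcs e := #|[set q : T * T | e q.1 q.2]|.

Lemma num_arcs_del e u v : symmetric e -> u != v -> e u v ->
  num_arcs (del_edge e u v) + 2 = num_arcs e.
Proof.
move=> sym uv euv; rewrite /num_arcs.
rewrite -[in RHS](cardsID [set (u, v); (v, u)]) addnC; congr addn.
  have /setIidPr -> : [set (u, v); (v, u)] \subset [set q | e q.1 q.2].
    by apply/subsetP => q /set2P[]->; rewrite inE //= sym.
  by rewrite cards2 xpair_eqE (negbTE uv).
apply: eq_card => -[s t]; rewrite !inE /del_edge /edge !xpair_eqE /=.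
by rewrite andbC.
Qed.

Lemma num_arcs_add e u v : num_arcs (add_edge e u v) <= num_arcs e + 2.
Proof.
have le2 : #|[set (u, v); (v, u)]| <= 2 by rewrite cards2; case: eqP.
apply: leq_trans (leq_add (leqnn _) le2); rewrite -cardsUI.
apply: leq_trans (leq_addr _ _); apply: subset_leq_card.
apply/subsetP => -[s t].
by rewrite !inE /add_edge /edge !xpair_eqE.
Qed.

(** Removing the edges of a path changes the parity exactly at its ends; the
    bound on arcs lets the path be traded for a single edge with a gain. *)
Lemma toggle_path e u p : symmetric e -> path e u p -> uniq (u :: p) ->
  exists f, [/\ symmetric f, subrel f e,
    forall s, parity f s = parity e s (+) ((s == u) (+) (s == last u p))
    & num_arcs f + (size p).*2 <= num_arcs e].
Proof.
elim: p e u => [|w p IHp] e u sym.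
  by move=> _ _; exists e; split=> // [s|]; rewrite ?addbb ?addbF // addn0.
rewrite [path _ _ _]/= [uniq _]/= => /andP[uw wp] /andP[uNp Up].
have neq_uw : u != w by case/norP: (uNp).
have wp' : path (del_edge e u w) w p.
  apply: (sub_in_path _ (allss _) wp) => s t sp tp est.
  rewrite /del_edge est /edge /= negb_or !negb_and.
  have -> : s != u by apply: contraNneq uNp => <-.
  by have -> : t != u by [apply: contraNneq uNp => <-]; rewrite orbT.
have [f [symf sub par arcs]] := IHp _ _ (del_sym _ _ sym) wp' Up.
exists f; split=> // [s t /sub /del_sub //|s|].
  rewrite par parity_del //= -!addbA; congr addb; congr addb.
  by rewrite addbA addbb.
by rewrite -(num_arcs_del sym neq_uw uw) /= doubleS -addn2 addnA leq_add2r.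
Qed.

Section Joins.
Variable G : sgraph T.
Local Notation V := (vertices G).

Lemma adj_neq u v : adj G u v -> u != v.
Proof. by apply: contraTneq => ->; rewrite adj_irrefl. Qed.

Lemma adj_vertices_r u v : adj G u v -> v \in V.
Proof. by rewrite adj_sym; apply: adj_vertices. Qed.

Lemma path_delete_vertex x y p : path (adj (delete_vertex G x)) y p ->
  path (adj G) y p /\ x \notin p.
Proof.
move=> yp; split; first by apply: sub_path yp => s t /and3P[].
elim: p y yp => //= t p IHp y /andP[/and3P[_ tx _] /IHp xNp].
by rewrite inE negb_or xNp andbT eq_sym; move: tx; rewrite !inE.
Qed.

(** For a subgraph [e] of [G] this says at once that [e] is a forest (case
    [e u v]: the edge is a bridge) and that its trees are induced subgraphs
    (case [~~ e u v]: an edge of [G] missing from [e] joins distinct trees). The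
    formulation by connectivity is inherited by subrelations. *)
Definition reduced e :=
  forall u v, adj G u v -> ~~ connect (del_edge e u v) u v.

(** Descent on the number of arcs: an edge [uv] violating the condition closes
    a cycle with a path of [e]. Toggling all edges of the cycle changes no
    parity, and loses edges since at most one of them, [uv], is outside [e]. *)
Lemma reduced_exists e : symmetric e -> subrel e (adj G) ->
  exists f, [/\ symmetric f, subrel f (adj G), reduced f
              & parity f =1 parity e].
Proof.
have [n] := ubnP (num_arcs e); elim: n e => // n IHn e.
rewrite ltnS => le_n sym sub.
case: (boolP [forall u, forall v,
                adj G u v ==> ~~ connect (del_edge e u v) u v]).
  move=> /forallP red; exists e; split=> // u v.
  by have /forallP/(_ v)/implyP := red u.
rewrite negb_forall => /existsP[u]; rewrite negb_forall => /existsP[v].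
rewrite negb_imply negbK => /andP[uv /connectP[p]].
have neq_uv := adj_neq uv.
case/shortenP => p' up' Up' _ lastv.
have sizep' : 0 < size p'.
  by case: p' lastv {up' Up'} => //= eq_vu; rewrite eq_vu eqxx in neq_uv.
have [f [symf subf]] := toggle_path (del_sym u v sym) up' Up'.
rewrite -lastv => parf arcs.
have subfG : subrel f (adj G) by move=> s t /subf /del_sub /sub.
(* If uv is in e, the whole cycle is removed; otherwise the path has at least
   two edges, and they are replaced by uv. *)
case: (boolP (e u v)) => euv.
  have [||//|g [symg subg redg parg]] := IHn f.
  - apply: leq_trans le_n; rewrite -(num_arcs_del sym neq_uv euv) addn2.
    by rewrite ltnS ltnW // ltnS; apply: leq_trans (leq_addr _ _) arcs.
  - exact: symf.
  exists g; split=> // s.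
  by rewrite parg parf parity_del // -addbA addbb addbF.
have size2 : 1 < size p'.
  case: p' up' lastv sizep' {Up' arcs parf} => [|w [|? ?]] //=.
  by rewrite andbT => /del_sub euw eq_vw; rewrite eq_vw euw in euv.
have nfuv : ~~ f u v by apply: contra euv => /subf /del_sub.
have delE : parity (del_edge e u v) =1 parity e.
  move=> s; apply: eq_parity => t; rewrite /del_edge.
  case: (boolP (edge u v s t)) => [/(edgeP sym)->|_]; rewrite ?andbT //.
  by rewrite (negbTE euv).
have [||s t|g [symg subg redg parg]] := IHn (add_edge f u v).
- have arcs' : num_arcs f + 4 <= num_arcs e.
    apply: (@leq_trans (num_arcs (del_edge e u v))); last first.
      by apply: subset_leq_card; apply/subsetP => q; rewrite !inE => /del_sub.
    by apply: leq_trans arcs; rewrite leq_add2l (leq_double 2).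
  apply: leq_trans le_n; apply: leq_trans arcs'; rewrite addnS.
  by rewrite ltnS (leq_trans (num_arcs_add _ _ _)) // leq_add2l.
- exact: add_sym.
- by case/orP=> [/subfG //|/(edgeP (@adj_sym _ G)) ->].
exists g; split=> // s.
by rewrite parg parity_add // parf delE -addbA addbb addbF.
Qed.

(** The edge sets of 1-perfect forests with even vertex [x]. *)
Definition near_odd x e :=
  [/\ x \in V, symmetric e, subrel e (adj G), reduced e
    & forall s, s \in V -> parity e s = (s != x)].

(** The sum modulo 2 of [G] and of [G] with a path removed is that path. *)
Lemma pair_join u v : connect (adj G) u v ->
  exists e, [/\ symmetric e, subrel e (adj G)
              & forall s, parity e s = (s == u) (+) (s == v)].
Proof.
case/connectP => p; case/shortenP => p' up' Up' _ ->.
have [f [symf subf parf _]] := toggle_path (@adj_sym _ G) up' Up'.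
exists (fun s t => adj G s t (+) f s t); split=> [s t|s t|s].
- by rewrite adj_sym symf.
- by case: (boolP (adj G s t)) => // /(contra (@subf s t))/negbTE->.
by rewrite parity_addb parf addKb.
Qed.

(** Add up, modulo 2, paths from [x] to all vertices: the parity at [v <> x] is
    odd, and at [x] it is that of [order_of G - 1]. *)
Lemma near_odd_exists x : connected G -> odd (order_of G) -> x \in V ->
  exists e, near_odd x e.
Proof.
move=> [_ conn] oddV xV.
suff [e [sym sub par]] : exists e, [/\ symmetric e, subrel e (adj G)
    & forall s, parity e s =
        \big[addb/false]_(v <- enum V) ((s == v) (+) (s == x))].
  have [f [symf subf redf parf]] := reduced_exists sym sub.
  exists f; split=> // s sV; rewrite parf par big_enum big_split /=.
  rewrite (bigD1 s) //= eqxx big1 => [|v /andP[_ /negbTE]]; last first.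
    by rewrite eq_sym.
  case: eqP => [_|_] /=; last by rewrite big1.
  have := oddV; rewrite /order_of -sum1_card (big_morph odd oddD (erefl _)).
  by move=> ->.
have: {subset enum V <= V} by move=> v; rewrite mem_enum.
elim: (enum _) => [|v vs IHvs] vsV.
  exists (fun _ _ => false); split=> // s; rewrite big_nil.
  by rewrite /parity big1.
have [|e [sym sub par]] := IHvs.
  by move=> w wvs; apply: vsV; rewrite inE wvs orbT.
have vV : v \in V by apply: vsV; rewrite mem_head.
have [f [symf subf parf]] := pair_join (conn v x vV xV).
exists (fun s t => f s t (+) e s t); split=> [s t|s t|s].
- by rewrite sym symf.
- by case: (boolP (f s t)) => [/subf //|_ /sub].
by rewrite parity_addb big_cons par parf.
Qed.
(** * From reduced joins to proper 1-perfect forests *)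

Lemma near_odd_proper x e y : near_odd x e -> e x y ->
  exists F : sgraph T, proper_one_perfect_forest F G.
Proof.
case=> xV sym sub red par xy.
have irr : irreflexive e by move=> s; apply/negP => /sub; rewrite adj_irrefl.
have eV s t : e s t -> s \in V by move/sub/adj_vertices.
(* A longer path of e between ends s, t adjacent in G would survive in e - st.
   This single fact yields acyclicity (a cycle is a path closed by an edge of
   e) and inducedness. *)
have chord s p :
    path e s p -> uniq (s :: p) -> adj G s (last s p) -> size p <= 1.
  case: p => [|a [|b p]] // /andP[sa abp] Up Gst; case/negP: (red _ _ Gst).
  set t := last _ _; set q := a :: b :: p.
  apply/connectP; exists q => //.
  rewrite -[path _ _ _]
    /(del_edge e s t s a && path (del_edge e s t) a (b :: p)).
  have [sNq aNq] : s \notin q /\ a \notin b :: p by case/andP: Up => ? /andP[].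
  have tq : t \in b :: p by rewrite /t /= mem_last.
  rewrite {1}/del_edge sa /edge eqxx /= negb_or negb_and.
  have -> : a != t by apply: contraNneq aNq => ->.
  have -> : s != t by apply: contraNneq sNq => ->; rewrite inE tq orbT.
  rewrite -[_ && _]/(path (del_edge e s t) a (b :: p)).
  have {}abp : path e a (b :: p) := abp.
  apply: (sub_in_path _ (allss _) abp) => c d cq dq cd.
  rewrite /del_edge cd /edge negb_or !negb_and.
  have -> : c != s by apply: contraNneq sNq => <-.
  by have -> : d != s by [apply: contraNneq sNq => <-]; rewrite orbT.
exists (SGraph sym irr eV); split; last first.
  move=> s sV; have [z sz] : exists z, e s z.
    case: (eqVneq s x) => [->|sx]; first by exists y.
    by apply: parity_neighbour; rewrite par.
  by rewrite /degree -lt0n; apply/card_gt0P; exists z; rewrite inE.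
split; [split=> // | |].
- move=> [//|s p] /andP[]; rewrite /= rcons_path => /andP[sp ps] Up.
  by apply: chord sp Up _; rewrite adj_sym; apply: sub.
- move=> s sV; split=> [|u v].
    split=> [|u v /and3P[_ _ /sub //]].
    by apply/subsetP => u; rewrite !inE => /andP[].
  rewrite !inE => /andP[_ su] /andP[_ sv] uv.
  rewrite /= /induce_adj !inE su sv /=.
  have: connect e u v by rewrite (connect_trans _ sv) // connect_symm.
  case/connectP => p; case/shortenP => p' up' Up' _ lastv.
  have := chord _ _ up' Up'; rewrite -lastv => /(_ uv).
  case: p' up' lastv {Up'} => [_ uv'|w [|? ?]] //=.
    by rewrite uv' adj_irrefl in uv.
  by rewrite andbT => uw ->.
rewrite (_ : [set _ in _ | _] = [set x]) ?cards1 //.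
apply/setP => s; rewrite !inE /degree odd_card /=.
case: (boolP (s \in V)) => [/par ->|sNV] /=; first by rewrite negbK.
by apply/esym/negbTE; apply: contraNneq sNV => ->.
Qed.

(** * Attaching and sliding an isolated even vertex *)

(** A leaf attached to [a] closes no cycle; it creates a chord only if [x] has
    another neighbour in the tree of [a]. *)
Lemma attach_leaf e x a : symmetric e -> subrel e (adj G) -> reduced e ->
  (forall t, ~~ e x t) -> adj G x a ->
  (forall v, connect e a v -> adj G x v -> v = a) ->
  reduced (add_edge e x a).
Proof.
move=> sym sub red iso xa only_a u v uv.
have neq_xa := adj_neq xa.
(* Contracting the new edge onto a. *)
pose h s := if s == x then a else s.
have hE s : s != x -> h s = s by rewrite /h => /negbTE ->.
have eNx s t : e s t -> (s != x) && (t != x).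
  move=> st; apply/andP; split; apply: contraTneq st => ->; first exact: iso.
  by rewrite sym; apply: iso.
have hom s t : add_edge e x a s t -> connect e (h s) (h t).
  case/orP=> [st|/orP[] /andP[/eqP-> /eqP->]].
  - by have /andP[sx tx] := eNx _ _ st; rewrite !hE //; apply: connect1.
  - by rewrite {1}/h eqxx hE // eq_sym.
  by rewrite {2}/h eqxx hE // eq_sym.
have xCase w :
    adj G x w -> connect (del_edge (add_edge e x a) x w) x w -> False.
  move=> xw con.
  have eq_wa : w = a.
    have con' : connect (add_edge e x a) x w.
      by apply: connect_sub con => s t /del_sub; apply: connect1.
    apply: only_a (xw); have := connect_map hom con'.
    by rewrite {1}/h eqxx hE // eq_sym adj_neq.
  suff /eqP eq_wx : pred1 x w by move: neq_xa; rewrite -eq_wa eq_wx eqxx.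
  apply: (connect_stable (P := pred1 x) _ con); last exact: eqxx.
  move=> s t st /eqP eq_sx; move: st.
  rewrite eq_sx eq_wa => /andP[/orP[xt|-> //]].
  by case/negP: (iso t).
apply/negP => con.
case: (eqVneq u x) => [eq_ux|ux].
  by move: uv con; rewrite eq_ux => uv; apply: xCase.
case: (eqVneq v x) => [eq_vx|vx].
  move: uv con; rewrite eq_vx adj_sym => /xCase xu con; apply: xu.
  rewrite connect_symm.
    apply: connect_sub con => s t st; apply: connect1; move: st.
    by rewrite /del_edge (edgeC x u).
  exact/del_sym/add_sym.
case/negP: (red _ _ uv).
rewrite -[X in connect _ X _](hE u ux) -[X in connect _ _ X](hE v vx).
apply: connect_map con => s t /andP[/orP[st|/orP st_xa] Nuv].
  have /andP[sx tx] := eNx _ _ st; rewrite !hE //; apply: connect1.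
  by rewrite /del_edge st.
by case: st_xa => /andP[/eqP-> /eqP->]; rewrite /h !eqxx if_same connect0.
Qed.
Lemma reduced_del e u v : reduced e -> reduced (del_edge e u v).
Proof.
move=> red s t st; apply: contra (red _ _ st); apply: connect_sub => c d.
by case/andP=> /del_sub cd Ncd; apply: connect1; rewrite /del_edge cd.
Qed.

Lemma add_sub e u v : subrel e (adj G) -> adj G u v ->
  subrel (add_edge e u v) (adj G).
Proof. by move=> sub uv s t /orP[/sub //|/(edgeP (@adj_sym _ G)) ->]. Qed.

Lemma near_odd_attach x e a : near_odd x e -> (forall t, ~~ e x t) ->
  adj G x a -> (forall v, connect e a v -> adj G x v -> v = a) ->
  near_odd a (add_edge e x a).
Proof.
move=> [xV sym sub red par] iso xa only_a; split.
- exact: adj_vertices_r xa.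
- exact: add_sym.
- exact: add_sub.
- exact: attach_leaf.
move=> s sV; rewrite (parity_add _ sym (adj_neq xa) (iso a)) par //.
by rewrite addbA addNb addbb.
Qed.

(** Cutting [ab] and hanging [x] on [a] moves the defect of parity from [x] to
    [b]; the tree of [x] is induced as [x] has no neighbour but [a] in the part
    of the tree on the side of [a]. *)
Lemma near_odd_slide x e a b : near_odd x e -> (forall t, ~~ e x t) ->
  e a b -> adj G x a ->
  (forall v, connect (del_edge e a b) a v -> adj G x v -> v = a) ->
  near_odd b (add_edge (del_edge e a b) x a).
Proof.
move=> [xV sym sub red par] iso ab xa only_a.
have iso' t : ~~ del_edge e a b x t by apply: contra (iso t) => /del_sub.
split.
- exact: adj_vertices_r (sub _ _ ab).
- exact/add_sym/del_sym.
- by apply: add_sub => // s t /del_sub /sub.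
- apply: attach_leaf => //; first exact: del_sym.
    by move=> s t /del_sub /sub.
  exact: reduced_del.
move=> s sV; have neq_ab := adj_neq (sub _ _ ab).
rewrite (parity_add _ (del_sym a b sym) (adj_neq xa) (iso' a)).
rewrite parity_del // par //.
by case: (s == x); case: (s == a); case: (s == b).
Qed.

(** * Graphs all of whose 1-perfect forests have an isolated vertex *)

Section NoProper.
Hypothesis isolated : forall x e t, near_odd x e -> ~~ e x t.

(** The tree of [e] containing [a] consists of the edge [ab]. *)
Definition lone_edge e a b :=
  [/\ e a b, forall t, e a t -> t = b & forall t, e b t -> t = a].

Lemma lone_edgeC e a b : symmetric e -> lone_edge e a b -> lone_edge e b a.
Proof. by move=> sym [ab onlyb onlya]; split=> //; rewrite sym. Qed.

Lemma lone_connect e a b v : lone_edge e a b -> connect e a v -> v = a \/ v = b.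
Proof.
move=> [ab onlyb onlya] con.
suff /orP[/eqP|/eqP] : (v == a) || (v == b) by [left | right].
apply: (connect_stable (P := fun v => (v == a) || (v == b)) _ con) => /= [s t|].
  move=> st /orP[]/eqP eq_s; move: st; rewrite eq_s.
    by move/onlyb->; rewrite eqxx orbT.
  by move/onlya->; rewrite eqxx.
by rewrite eqxx.
Qed.

Lemma leaf_connect e b v : (forall t, ~~ e b t) -> connect e b v -> v = b.
Proof.
move=> iso con; apply/eqP; apply: (connect_stable (P := pred1 b) _ con) => /=.
  by move=> s t st /eqP eq_s; move: st; rewrite eq_s (negbTE (iso t)).
exact: eqxx.
Qed.

(** Every tree of [e] containing a neighbour of [x] is an edge. Choose an edge
    [ab] of the tree for which the side [C] of [a] contains a neighbour of [x]
    and is smallest; then [a] is the only neighbour of [x] in [C]. Sliding [x]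
    to [a] leaves [b] as the even vertex, which must be isolated, so [b] is a leaf
    of the tree. If [b] were not adjacent to [x], then [x] could be hung on [a]
    with nothing cut, making [a] an even vertex of positive degree. So [b] is
    adjacent to [x], and sliding [x] to [b] shows that [a] is a leaf as well. *)
Lemma neighbour_lone_edge x e a0 : near_odd x e -> adj G x a0 ->
  exists2 b, lone_edge e a0 b & adj G x b.
Proof.
move=> nx xa0; have iso t := isolated t nx; have [xV sym sub red par] := nx.
have a0V := adj_vertices_r xa0.
have [b0 ab0] : exists b, e a0 b.
  by apply: parity_neighbour; rewrite par // eq_sym adj_neq.
pose C (p : T * T) := [set v | connect (del_edge e p.1 p.2) p.1 v].
pose P (p : T * T) := [&& e p.1 p.2, connect e a0 p.1
                         & [exists v in C p, adj G x v]].
have P0 : P (a0, b0).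
  rewrite /P /= ab0 connect0; apply/existsP; exists a0.
  by rewrite inE connect0.
have [[a b]] := arg_minnP (fun p => #|C p|) P0.
case/and3P => /= ab a0a /existsP[c /andP[cC xc]] min.
have only_a v : connect (del_edge e a b) a v -> adj G x v -> v = a.
  move=> av xv; apply/eqP/negPn/negP => va.
  (* Towards a, the edge vw at v cuts off a strictly smaller side. *)
  have symd := del_sym a b sym.
  have: connect (del_edge e a b) v a by rewrite connect_symm.
  case/connectP => p; case/shortenP => -[|w q] vq Uq _ lasta.
    by rewrite lasta eqxx in va.
  case/andP: vq => vw wq; have /andP[vNq _] := Uq.
  have wq' : connect (del_edge e v w) w a.
    apply/connectP; exists q => //; apply: (sub_in_path _ (allss _) wq).
    move=> s t sq tq /del_sub st; rewrite /del_edge st /edge negb_or !negb_and.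
    have -> : s != v by apply: contraNneq vNq => <-.
    by have -> : t != v by [apply: contraNneq vNq => <-]; rewrite orbT.
  have vNa : ~~ connect (del_edge e v w) v a.
    apply: contra (red _ _ (sub _ _ (del_sub vw))) => /connect_trans; apply.
    by rewrite connect_symm //; apply: del_sym.
  suff: #|C (v, w)| < #|C (a, b)|.
    rewrite ltnNge min // /P /= (del_sub vw) /=; apply/andP; split.
      apply: connect_trans a0a _; apply: connect_sub av => s t /del_sub.
      exact: connect1.
    by apply/existsP; exists v; rewrite inE connect0.
  apply: proper_card; apply/properP; split; last first.
    by exists a; rewrite inE ?connect0.
  apply/subsetP => u; rewrite !inE => vu; apply: connect_trans av _.
  pose Q s := connect (del_edge e v w) v s && connect (del_edge e a b) v s.
  have /andP[//] : Q u.
  apply: (connect_stable (P := Q) _ vu); last by rewrite /Q !connect0.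
  move=> s t st /andP[vs vs'].
  rewrite /Q (connect_trans vs (connect1 st)).
  apply: connect_trans vs' (connect1 _).
  rewrite /del_edge (del_sub st).
  apply/negP => /orP[] /andP[/eqP eq_s /eqP eq_t].
    by case/negP: vNa; rewrite -eq_s.
  case/negP: vNa; rewrite -eq_t; exact: connect_trans vs (connect1 st).
have xa : adj G x a by rewrite -(only_a c) //; rewrite inE in cC.
have onlya t : e b t -> t = a.
  move=> bt; apply/eqP/negPn/negP => ta.
  case/negP: (isolated t (near_odd_slide nx iso ab xa only_a)).
  rewrite /add_edge /del_edge bt /edge (negbTE ta) andbF orbF /=.
  by rewrite eq_sym (negbTE (adj_neq (sub _ _ ab))).
have xb : adj G x b.
  apply/negPn/negP => Nxb.
  suff /(isolated x)/negP[] : near_odd a (add_edge e x a).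
    by rewrite /add_edge /edge !eqxx !orbT.
  apply: near_odd_attach => // v av xv; apply: only_a => //.
  (* Contracting the leaf b onto a. *)
  pose h s := if s == b then a else s.
  have hE s : s != b -> h s = s by rewrite /h => /negbTE ->.
  have vb : v != b by apply: contraNneq Nxb => <-.
  have neq_ab := adj_neq (sub _ _ ab).
  rewrite -[v]hE // -{2}[a]hE //; apply: connect_map av => s t st.
  rewrite /h; case: (eqVneq s b) st => [->|sb] st.
    by rewrite (onlya t) // (negbTE neq_ab).
  case: (eqVneq t b) st => [->|tb] st; first by rewrite (onlya s) // sym.
  apply: connect1; rewrite /del_edge st /edge (negbTE tb) (negbTE sb).
  by rewrite andbF.
have onlyb t : e a t -> t = b.
  move=> at_; apply/eqP/negPn/negP => tb.
  have ba : e b a by rewrite sym.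
  have nx' : near_odd a (add_edge (del_edge e b a) x b).
    apply: near_odd_slide => // v /leaf_connect-> // t'.
    by apply/negP => /andP[/onlya ->]; rewrite edge_id.
  case/negP: (isolated t nx').
  rewrite /add_edge /del_edge at_ /edge (negbTE tb) andbF orbF /=.
  by rewrite (negbTE (adj_neq (sub _ _ ab))).
have lone_ab : lone_edge e a b by [].
have aa0 : connect e a a0 by rewrite connect_symm.
case: (lone_connect lone_ab aa0) => ->; first by exists b.
by exists a => //; apply: lone_edgeC.
Qed.

(** Rotating the triangle [xab]: [xb] replaces [ab], and [a] becomes the
    isolated vertex. *)
Lemma near_odd_shift x e a b : near_odd x e -> lone_edge e a b -> adj G x b ->
  near_odd a (add_edge (del_edge e b a) x b).
Proof.
move=> nx [ab onlyb onlya] xb; have [_ sym _ _ _] := nx.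
apply: near_odd_slide => // [t||v /leaf_connect-> //].
- exact: isolated nx.
- by rewrite sym.
by move=> t; apply/negP => /andP[/onlya ->]; rewrite edge_id.
Qed.

Lemma shift_keeps e a b x s t : e s t -> t != a -> t != b ->
  add_edge (del_edge e b a) x b s t.
Proof.
move=> st ta tb; rewrite /add_edge /del_edge st /edge.
by rewrite (negbTE ta) (negbTE tb) !andbF.
Qed.

(** Repeated shifts carry the isolated vertex along a walk of [G], without
    touching a forest edge [xy] that the walk avoids. *)
Lemma walk_shift c e x y p : near_odd c e -> e x y -> path (adj G) c p ->
  x \notin p -> y \notin p ->
  exists2 f, near_odd (last c p) f & f x y.
Proof.
elim: p c e => [|d p IHp] c e nc xy /=; first by exists e.
case/andP=> cd dp; rewrite !inE !negb_or => /andP[xd xNp] /andP[yd yNp].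
have [d' lone_d cd'] := neighbour_lone_edge nc cd.
have [dd' onlyd' onlyd] := lone_d.
apply: IHp dp xNp yNp; first exact: near_odd_shift nc lone_d cd'.
apply: shift_keeps; rewrite // ; apply: contraNneq xd => eq_yd'.
by rewrite [x]onlyd // -eq_yd'; have [_ sym _ _ _] := nc; rewrite sym.
Qed.

(** Shift first to [y], which turns [xy'] into a forest edge, and then on to the
    end [z] of the walk. As [z] is now isolated and adjacent to [x], it is
    adjacent to both ends of the lone edge [xy']. *)
Lemma walk_to_partner x e y y' p : near_odd x e -> lone_edge e y y' ->
  adj G x y' -> path (adj (delete_vertex G x)) y p -> y' \notin p ->
  adj G x (last y p) -> adj G (last y p) y'.
Proof.
move=> nx lone_y xy' yp y'Np xz.
have xy'_ : add_edge (del_edge e y' y) x y' x y'.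
  by rewrite /add_edge edge_id orbT.
have [Gyp xNp] := path_delete_vertex yp.
have ny := near_odd_shift nx lone_y xy'.
have [f nz fxy'] := walk_shift ny xy'_ Gyp xNp y'Np.
rewrite adj_sym in xz; have [b [_ only_b _] zb] := neighbour_lone_edge nz xz.
by rewrite (only_b y').
Qed.

(** After shifting from [x] to [z], the forest edge [yy'] is still there, so [z]
    is adjacent to both of its ends or to none. *)
Lemma adjacent_partner x e y y' z : near_odd x e -> lone_edge e y y' ->
  adj G x z -> z != y -> z != y' -> adj G z y' -> adj G z y.
Proof.
move=> nx [yy' only_y' only_y] xz zy zy' Gzy'.
have [z' lone_z xz'] := neighbour_lone_edge nx xz.
have [zz' only_z' only_z] := lone_z; have [_ sym _ _ _] := nx.
have nz := near_odd_shift nx lone_z xz'.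
have z'y : z' != y.
  by apply: contraNneq zy' => eq_z'; rewrite -(only_y' z) // -eq_z' sym.
have keep : add_edge (del_edge e z' z) x z' y' y.
  by apply: shift_keeps; rewrite 1?eq_sym // sym.
have [b [_ only_b _] zb] := neighbour_lone_edge nz Gzy'.
by rewrite (only_b y).
Qed.

(** The walk from [y] to [z] either avoids the partner [y'] of [y], or contains
    a walk from [y'] to [z] that avoids [y]. *)
Lemma neighbours_adjacent x e y z : near_odd x e -> adj G x y -> adj G x z ->
  connect (adj (delete_vertex G x)) y z -> y != z -> adj G y z.
Proof.
move=> nx xy xz /connectP[p]; case/shortenP => p' yp' Up' _ eq_z yz.
have [y' lone_y xy'] := neighbour_lone_edge nx xy.
have [_ sym sub _ _] := nx; have [yy' _ _] := lone_y.
case: (eqVneq z y') => [->|zy']; first exact: sub.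
rewrite adj_sym; case: (boolP (y' \in p')) => [y'p|y'Np]; last first.
  apply: (adjacent_partner nx lone_y xz _ zy'); first by rewrite eq_sym.
  rewrite eq_z; rewrite eq_z in xz.
  exact: walk_to_partner nx lone_y xy' yp' y'Np xz.
case/splitPr: y'p yp' Up' eq_z => p1 p2; rewrite cat_path /= last_cat /=.
case/and3P=> _ _ y'p2; rewrite mem_cat inE !negb_or.
case/andP=> /and3P[_ _ yNp2] _ eq_z.
rewrite eq_z; rewrite eq_z in xz.
exact: walk_to_partner nx (lone_edgeC sym lone_y) xy y'p2 yNp2 xz.
Qed.

End NoProper.
(** * Blocks *)

Lemma closed_vertices (H : sgraph T) : closed (adj H) (vertices H).
Proof.
apply: intro_closed => [|u v uv _]; first exact: sym_connect_sym (@adj_sym _ H).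
by apply: (@adj_vertices _ H v u); rewrite adj_sym.
Qed.

Lemma num_components_le1 (H : sgraph T) : (num_components H <= 1) <->
  {in vertices H &, forall u v, connect (adj H) u v}.
Proof.
have symH := sym_connect_sym (@adj_sym _ H).
have closedV := @closed_vertices H.
rewrite /num_components /n_comp_mem; split=> [/card_le1_eqP le1 u v uV vV|conV].
  rewrite -(root_connect symH); apply/eqP; apply: le1; rewrite !inE /=.
    by rewrite roots_root // -(closed_connect closedV (connect_root _ v)).
  by rewrite roots_root // -(closed_connect closedV (connect_root _ u)).
apply/card_le1_eqP => u v /andP[/eqP ru uV] /andP[/eqP rv vV].
by rewrite -ru -rv; apply/(rootP symH); apply: conV.
Qed.

Lemma no_cut_vertexP (H : sgraph T) : connected_without_cut_vertex H <->
  [/\ vertices H != set0, {in vertices H &, forall u v, connect (adj H) u v}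
    & forall w, {in vertices H :\ w &, forall u v,
        connect (adj (delete_vertex H w)) u v}].
Proof.
split=> [[[nonempty con] nocut]|[nonempty con con']].
  split=> // w u v /setD1P[uw uH] /setD1P[vw vH].
  case: (boolP (w \in vertices H)) => wH; last first.
    apply: connect_sub (con u v uH vH) => s t st; apply: connect1.
    rewrite /= /induce_adj !inE st andbT; apply/andP; split.
      by apply: contraNneq wH => <-; apply: adj_vertices st.
    apply: contraNneq wH => <-; rewrite adj_sym in st.
    exact: adj_vertices st.
  have [le1 _] := num_components_le1 (delete_vertex H w).
  apply: le1; rewrite ?inE ?uw ?vw ?uH ?vH //.
  have /num_components_le1 leH := con; apply: leq_trans leH.
  by rewrite leqNgt; apply/negP => lt; case: (nocut w).
split=> // w [wH]; apply/negP; rewrite -leqNgt.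
apply: (@leq_trans 1); last first.
  rewrite /num_components /n_comp_mem; apply/card_gt0P; exists (root (adj H) w).
  have symH := sym_connect_sym (@adj_sym _ H).
  rewrite !inE /= roots_root //.
  by rewrite -(closed_connect (@closed_vertices H) (connect_root _ w)).
apply/num_components_le1 => u v; rewrite !inE => /andP[uH uw] /andP[vH vw].
by apply: con'; rewrite !inE ?uw ?vw.
Qed.

Definition connects (A : {set T}) :=
  [forall u in A, forall v in A, connect (induce_adj G A) u v].

Lemma connectsP (A : {set T}) :
  reflect {in A &, forall u v, connect (induce_adj G A) u v} (connects A).
Proof.
apply: (iffP forall_inP) => [con u v uA vA|con u uA].
  by have /forall_inP := con u uA; apply.
by apply/forall_inP => v; apply: con.
Qed.

(** A boolean form of [connected_without_cut_vertex] for induced subgraphs, so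
    that a maximal set of vertices can be taken. *)
Definition nonseparable (A : {set T}) :=
  [&& A != set0, A \subset V, connects A & [forall w, connects (A :\ w)]].

Lemma vertices_induce (A : {set T}) : A \subset V -> vertices (induce G A) = A.
Proof. by move/setIidPr. Qed.

Lemma nonseparable_induce (A : {set T}) : nonseparable A ->
  connected_without_cut_vertex (induce G A).
Proof.
case/and4P=> nonempty AV /connectsP con /forallP con'.
apply/no_cut_vertexP; rewrite vertices_induce //; split=> // w u v uA vA.
have /connectsP := con' w; move/(_ u v uA vA); apply: connect_sub => s t.
rewrite /induce_adj !inE => /and3P[/andP[sw sA] /andP[tw tA] st].
apply: connect1; rewrite /= /induce_adj !inE /= /induce_adj.
exact/and5P.
Qed.

Lemma nonseparable_vertices (H : sgraph T) : subgraph H G ->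
  connected_without_cut_vertex H -> nonseparable (vertices H).
Proof.
case=> VH EH /no_cut_vertexP[nonempty con con'].
have endV u v : adj H u v -> (u \in vertices H) && (v \in vertices H).
  move=> uv; rewrite (adj_vertices uv) /=.
  by rewrite adj_sym in uv; apply: adj_vertices uv.
apply/and4P; split=> //.
  apply/connectsP => u v uH vH; apply: connect_sub (con u v uH vH) => s t st.
  by apply: connect1; rewrite /induce_adj andbA endV // EH.
apply/forallP => w; apply/connectsP => u v uH vH.
apply: connect_sub (con' w u v uH vH) => s t.
rewrite /= /induce_adj !inE => /and3P[sw tw st].
apply: connect1.
by rewrite /induce_adj !inE sw tw (EH _ _ st) !andTb andbT endV.
Qed.

(** Adding edges between its vertices keeps a subgraph free of cut-vertices, so
    a block is determined by a maximal set of vertices. *)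
Lemma block_above (A : {set T}) : nonseparable A ->
  exists B : {set T}, [/\ A \subset B, B \subset V, block (induce G B) G
    & forall B', nonseparable B' -> B \subset B' -> B' = B].
Proof.
case/maxset_exists => B /maxsetP[nonsepB maxB] AB.
have /and4P[_ BV _ _] := nonsepB.
exists B; split=> //; split=> [||H' H'G ncH' [BH' _]].
- by split=> [|u v /and3P[]//]; rewrite vertices_induce.
- exact: nonseparable_induce.
rewrite vertices_induce // in BH'.
have eqB := maxB _ (nonseparable_vertices H'G ncH') BH'.
split=> [|u v uv]; first by rewrite vertices_induce // eqB.
rewrite /= /induce_adj -eqB (adj_vertices uv) (H'G.2 _ _ uv) andbT /=.
by rewrite adj_sym in uv; apply: adj_vertices uv.
Qed.

Lemma clique_nonseparable (A : {set T}) : A != set0 -> A \subset V ->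
  {in A &, forall u v, u != v -> adj G u v} -> nonseparable A.
Proof.
move=> nonempty AV cliqueA.
have con (B : {set T}) : B \subset A -> connects B.
  move=> /subsetP BA; apply/connectsP => u v uB vB.
  case: (eqVneq u v) => [->//|uv]; apply: connect1.
  by rewrite /induce_adj uB vB cliqueA ?BA.
by apply/and4P; split; rewrite ?con //; apply/forallP => w; apply/con/subsetDl.
Qed.

Lemma block_maximal (H : sgraph T) (A : {set T}) : block H G ->
  vertices H \subset A -> nonseparable A -> subgraph (induce G A) H.
Proof.
case=> [[VH EH] _ maxH] HA nonsepA; have /and4P[_ AV _ _] := nonsepA.
apply: maxH; last split.
- by split=> [|u v /and3P[]//]; rewrite vertices_induce.
- exact: nonseparable_induce.
- by rewrite vertices_induce.
move=> u v uv; rewrite /= /induce_adj (EH _ _ uv) andbT.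
rewrite (subsetP HA) ?(adj_vertices uv) //=; rewrite adj_sym in uv.
by rewrite (subsetP HA) ?(adj_vertices uv).
Qed.

(** Being equal or adjacent to a fixed vertex [u] of a block [H] propagates
    along the edges [st] of [H], because [u] and [t] are neighbours of [s] joined
    in [H - s]. Hence [H] is a clique. For the parity, fix [x] in [H] and a
    forest [e] leaving [x] isolated. The partner [b] of a vertex [s] of [H - x]
    is adjacent to every other [z] in [H], as [zsb] is a path of [G - x] between
    neighbours of [x]. So [b] is in [H] by maximality, and [e] matches the
    vertices of [H - x] in pairs. *)
Lemma isolated_odd_complete_blocks : connected G -> odd (order_of G) ->
  (forall x e t, near_odd x e -> ~~ e x t) -> odd_complete_blocks G.
Proof.
move=> Gconn Godd isolated; split=> // H blockH.
have [[VH EH] /no_cut_vertexP[nonempty con con'] _] := blockH.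
have near x (xV : x \in V) := near_odd_exists Gconn Godd xV.
have nbrs x y z : adj G x y -> adj G x z ->
    connect (adj (delete_vertex G x)) y z -> y != z -> adj G y z.
  move=> xy xz; have [e nx] := near x (adj_vertices xy).
  exact: neighbours_adjacent isolated _ _ _ _ nx xy xz.
have clique : {in vertices H &, forall u v, u != v -> adj G u v}.
  move=> u v uH vH uv.
  have /orP[/eqP eq_vu|//] : (v == u) || adj G u v; last first.
    by rewrite eq_vu eqxx in uv.
  pose P s := (s == u) || adj G u s.
  apply: (connect_stable (P := P) _ (con u v uH vH)); last by rewrite /P eqxx.
  move=> s t st; rewrite /P => /orP[/eqP <-|us].
    by rewrite (EH _ _ st) orbT.
  case: (eqVneq t u) => //= tu.
  have sH := adj_vertices st; have tH : t \in vertices H.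
    by rewrite adj_sym in st; apply: adj_vertices st.
  apply: (nbrs s) => //; [by rewrite adj_sym|exact: EH| |by rewrite eq_sym].
  have : connect (adj (delete_vertex H s)) u t.
    have ts := adj_neq (EH _ _ st); rewrite eq_sym in ts.
    by apply: con'; rewrite !inE ?uH ?tH ?ts ?(adj_neq us).
  apply: connect_sub => c d /and3P[cs ds cd]; apply: connect1.
  by rewrite /= /induce_adj cs ds EH.
split.
  have nsH := clique_nonseparable nonempty VH clique.
  have [_ HH] := block_maximal blockH (subxx _) nsH.
  by move=> u v uH vH uv; apply: HH; rewrite /= /induce_adj uH vH clique.
have /set0Pn[x xH] := nonempty.
have [e nx] := near x (subsetP VH x xH); have [_ sym sub _ _] := nx.
rewrite /order_of (cardsD1 x) xH /= .
apply: (even_card_of_odd sym) => [s|s /setD1P[sx sH]].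
  by apply/negP => /sub; rewrite adj_irrefl.
have xs : adj G x s by apply: clique; rewrite // eq_sym.
have [b [sb only_b _] xb] := neighbour_lone_edge isolated nx xs.
have bH : b \in vertices H.
  have cliqueb : {in b |: vertices H &, forall u v, u != v -> adj G u v}.
    have adj_b u : u \in vertices H -> u != b -> adj G u b.
      move=> uH ub; case: (eqVneq u x) => [->//|ux].
      case: (eqVneq u s) => [->|us]; first exact: sub.
      apply: (nbrs x) => //; first by apply: clique; rewrite // eq_sym.
      have sE : s \in [set~ x] by rewrite !inE.
      apply: (@connect_trans _ _ s); apply: connect1;
        rewrite /= /induce_adj sE /=.
        by rewrite !inE ux clique.
      by rewrite !inE (sub _ _ sb) eq_sym adj_neq.
    move=> u v /setU1P[->|uH] /setU1P[->|vH]; rewrite ?eqxx //.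
    - by rewrite eq_sym adj_sym; apply: adj_b.
    - exact: adj_b.
    exact: clique.
  have bV : b |: vertices H \subset V.
    by rewrite subUset VH sub1set (adj_vertices_r xb).
  have nonemptyb : b |: vertices H != set0.
    by apply/set0Pn; exists b; rewrite setU11.
  have nsb := clique_nonseparable nonemptyb bV cliqueb.
  have [sub_bH _] := block_maximal blockH (subsetUr _ _) nsb.
  by apply: (subsetP sub_bH); rewrite vertices_induce // setU11.
rewrite /is_true -[RHS](parity_pred1 b); apply: eq_bigr => t _; rewrite !inE.
apply/andP/idP=> [[_ /only_b ->] //|/eqP->].
by rewrite sb bH andbT eq_sym adj_neq.
Qed.
(** * Graphs with odd complete blocks *)

Lemma walk_connects s p : path (adj G) s p -> connects [set t in s :: p].
Proof.
move=> sp; have sp' : path (induce_adj G [set t in s :: p]) s p.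
  apply: (sub_in_path _ (allss _) sp) => c d cq dq cd.
  by rewrite /induce_adj !in_set cd andbT; apply/andP.
have symA := induce_sym G [set t in s :: p].
apply/connectsP => u v; rewrite !in_set => uq vq.
apply: (@connect_trans _ _ s); last exact: (path_connect sp' vq).
by rewrite connect_symm //; apply: (path_connect sp' uq).
Qed.

(** A cycle rotated to start at [w] is a path once [w] is deleted. *)
Lemma cycle_nonseparable c : c != [::] -> cycle (adj G) c -> uniq c ->
  {subset c <= V} -> nonseparable [set t in c].
Proof.
case: c => // a c _ cyc Uc cV.
have conn_c : connects [set t in a :: c].
  by apply: walk_connects; move: cyc; rewrite /= rcons_path => /andP[].
apply/and4P; split=> //.
- by apply/set0Pn; exists a; rewrite inE mem_head.
- by apply/subsetP => t; rewrite inE; apply: cV.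
apply/forallP => w; case: (boolP (w \in a :: c)) => [wc|wNc]; last first.
  suff -> : [set t in a :: c] :\ w = [set t in a :: c] by [].
  by apply/setDidPl; rewrite disjoint_sym disjoints1 inE.
have [i q rotE] := rot_to wc.
have : cycle (adj G) (w :: q) by rewrite -rotE rot_cycle.
have : uniq (w :: q) by rewrite -rotE rot_uniq.
have -> : [set t in a :: c] :\ w = [set t in w :: q] :\ w.
  by apply/setP => t; rewrite !in_setD1 !in_set -rotE mem_rot.
case/andP=> wNq _ cyc_q.
have -> : [set t in w :: q] :\ w = [set t in q].
  apply/setP => t; rewrite !inE; case: eqVneq => //= ->.
  by rewrite (negbTE wNq).
case: q cyc_q {rotE wNq} => [_|b q].
  by apply/connectsP => u v; rewrite inE.
by rewrite /= rcons_path => /and3P[_ bq _]; apply: walk_connects.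
Qed.

Section OddCompleteBlocks.
Hypothesis Gconn : connected G.
Hypothesis blocks : forall H, block H G -> complete H /\ odd (order_of H).

Lemma odd_maximal_clique (A : {set T}) : nonseparable A ->
  exists B : {set T}, [/\ A \subset B,
    {in B &, forall u v, u != v -> adj G u v},
    odd #|B| & forall u, {in B, forall v, u != v -> adj G u v} -> u \in B].
Proof.
move=> nsA; have [B [AB BV blockB maxB]] := block_above nsA.
have [cliqueB oddB] := blocks blockB.
rewrite /order_of vertices_induce // in oddB.
have {}cliqueB : {in B &, forall u v, u != v -> adj G u v}.
  move=> u v uB vB uv; have := cliqueB u v.
  by rewrite vertices_induce // => /(_ uB vB uv) /and3P[].
exists B; split=> // u adj_u.
have [b bB] : exists b, b \in B.
  by apply/set0Pn; rewrite -card_gt0; case: #|B| oddB.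
have uV : u \in V.
  case: (eqVneq u b) => [->|ub]; first exact: (subsetP BV).
  exact: adj_vertices (adj_u b bB ub).
rewrite -(maxB (u |: B)) ?setU11 ?subsetUr //.
apply: clique_nonseparable.
- by apply/set0Pn; exists u; rewrite setU11.
- by rewrite subUset sub1set uV.
move=> s t /setU1P[->|sB] /setU1P[->|tB]; rewrite ?eqxx //.
- exact: adj_u.
- by rewrite eq_sym adj_sym; apply: adj_u.
exact: cliqueB.
Qed.

(** The path closes through [x] to a cycle, which lies in a block. *)
Lemma clique_neighbours x y z : adj G x y -> adj G x z ->
  connect (adj (delete_vertex G x)) y z -> y != z -> adj G y z.
Proof.
move=> xy xz /connectP[p]; case/shortenP => p' yp' Up' _ eq_z yz.
have [Gyp' xNp] := path_delete_vertex yp'.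
have nsC : nonseparable [set t in x :: y :: p'].
  apply: cycle_nonseparable => //.
  - by rewrite /= rcons_path xy Gyp' -eq_z adj_sym.
  - by rewrite cons_uniq Up' andbT inE negb_or xNp adj_neq.
  move=> t; rewrite !inE => /or3P[/eqP->|/eqP->|].
  - exact: adj_vertices xy.
  - exact: adj_vertices_r xy.
  elim: p' y Gyp' {Up' eq_z yz yp' xNp xy} => //= s q IHq y /andP[ys sq].
  by rewrite inE => /orP[/eqP->|]; [apply: adj_vertices_r ys|apply: IHq sq].
have [B [/subsetP CB cliqueB _ _]] := odd_maximal_clique nsC.
apply: cliqueB yz; apply: CB; rewrite !inE ?eqxx ?orbT // eq_z.
by rewrite -in_cons mem_last orbT.
Qed.

(** [A] is a union of components of [G - q]. If it is not empty, it contains a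
    neighbour [y] of [q], hence all of the block [Q] of [qy] except [q]: an even
    number of vertices. The rest splits into components [D] of [G - Q]. Each [D]
    is attached to a single vertex [q'] of [Q], as a vertex of [D] adjacent to
    one of two attachment vertices would be adjacent to all of [Q]. So [D] is
    closed in [G - q'], and even by induction. *)
Lemma even_separated q (A : {set T}) : q \in V -> A \subset V -> q \notin A ->
  (forall s t, s \in A -> adj G s t -> t != q -> t \in A) -> ~~ odd #|A|.
Proof.
have [n] := ubnP #|A|; elim: n q A => // n IHn q A.
rewrite ltnS => leAn qV AV qNA clA.
case: (set_0Vmem A) => [->|[u uA]]; first by rewrite cards0.
have [y yA qy] : exists2 y, y \in A & adj G q y.
  apply/exists_inP; case: (boolP [exists _ in _, _]) => // /exists_inPn Nq.
  case/negP: qNA; have [_ con] := Gconn.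
  apply: (connect_stable (P := mem A) _ (con u q (subsetP AV u uA) qV)) uA.
  move=> s t st sA; apply: (clA _ _ sA st); apply: contraTneq st => ->.
  by rewrite adj_sym; apply: (Nq s sA).
have nsqy : nonseparable [set q; y].
  apply: clique_nonseparable; first by apply/set0Pn; exists q; rewrite set21.
    by apply/subsetP => t /set2P[]->; last exact: adj_vertices_r qy.
  by move=> s t /set2P[]-> /set2P[]->; rewrite ?eqxx // adj_sym.
have [Q [qyQ cliqueQ oddQ maxQ]] := odd_maximal_clique nsqy.
have qQ : q \in Q by rewrite (subsetP qyQ) ?set21.
have yQ : y \in Q by rewrite (subsetP qyQ) ?set22.
have AIQ : A :&: Q = Q :\ q.
  apply/setP => r; rewrite !inE; case: (eqVneq r q) => [->|rq] /=.
    by rewrite (negbTE qNA).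
  case: (boolP (r \in Q)) => rQ; rewrite ?andbF ?andbT //.
  case: (eqVneq r y) => [->//|ry].
  by apply: (clA _ _ yA _ rq); apply: cliqueQ; rewrite // eq_sym.
rewrite -(cardsID Q A) AIQ oddD.
have -> : odd #|Q :\ q| = false.
  by move: oddQ; rewrite (cardsD1 q) qQ /=; case: odd.
have symR := induce_sym G (~: Q).
apply: (even_card_classes symR) => d /setDP[dA dNQ].
set D := [set _ in _ | _].
have DA : D \subset A :\: Q by apply/subsetP => t; rewrite inE => /andP[].
have inD s : s \in D ->
    [/\ s \in A, s \notin Q & connect (induce_adj G (~: Q)) d s].
  by rewrite !inE => /andP[/andP[]].
(* If D had no neighbour in Q, any vertex of Q would serve. *)
have attached : exists2 q', q' \in Q & forall s t, s \in D -> adj G s t ->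
    t \in Q -> t = q'.
  case: (boolP [exists u in D, exists q' in Q, adj G u q']); last first.
    move/exists_inPn => none; exists q => // s t sD st tQ.
    by have /exists_inPn/(_ t tQ) := none s sD; rewrite st.
  case/exists_inP => v vD /exists_inP[q' q'Q vq']; exists q' => // s t sD st tQ.
  apply/eqP/negPn/negP => tq'.
  have [vA vNQ dv] := inD v vD; have [sA sNQ ds] := inD s sD.
  case/negP: vNQ; apply: maxQ => r rQ vr.
  case: (eqVneq r q') => [->//|rq'].
  apply: (@clique_neighbours q') => //; first by rewrite adj_sym.
    by apply: cliqueQ; rewrite // eq_sym.
  have NQ_neq w : w \notin Q -> w != q' by apply: contraNneq => ->.
  have step c d' : c != q' -> d' != q' -> adj G c d' ->
      connect (adj (delete_vertex G q')) c d'.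
    by move=> cq' dq' cd; apply: connect1; rewrite /= /induce_adj !inE cq' dq'.
  apply: (@connect_trans _ _ s).
    have vs : connect (induce_adj G (~: Q)) v s.
      by apply: connect_trans ds; rewrite connect_symm.
    apply: connect_sub vs => c d'.
    rewrite /induce_adj !in_setC => /and3P[cQ dQ cd].
    by apply: step => //; apply: NQ_neq.
  apply: (@connect_trans _ _ t); first exact: step (NQ_neq _ sNQ) tq' st.
  case: (eqVneq t r) => [->//|tr]; apply: step => //; exact: cliqueQ.
have [q' q'Q att] := attached.
have q'V : q' \in V.
  case: (eqVneq q' y) => [->|q'y]; first exact: (subsetP AV).
  exact: adj_vertices (cliqueQ _ _ q'Q yQ q'y).
apply: (IHn q') => //.
- apply: leq_trans leAn; apply: (leq_ltn_trans (subset_leq_card DA)).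
  apply: proper_card; apply/properP; split; first exact: subsetDl.
  by exists y; rewrite // inE yQ.
- by apply: subset_trans DA _; apply: subset_trans (subsetDl _ _) AV.
- by apply/negP => /inD[_]; rewrite q'Q.
move=> s t sD st tq'; have [sA sNQ ds] := inD s sD.
case: (boolP (t \in Q)) => tQ; first by rewrite (att s t) ?eqxx in tq'.
have tA : t \in A by apply: (clA _ _ sA st); apply: contraNneq tQ => ->.
rewrite !inE tQ tA /=; apply: connect_trans ds (connect1 _).
by rewrite /induce_adj !inE sNQ tQ.
Qed.

Lemma no_proper_forest F : ~ proper_one_perfect_forest F G.
Proof.
case=> [[[[VF EF] eqV forestF] indF one_even] nonzero].
have /cards1P[x evenE] : #|[set x in vertices F | ~~ odd (degree F x)]| == 1.
  by rewrite one_even.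
have : x \in [set x] by rewrite set11.
rewrite -evenE inE => /andP[xF even_x].
have odd_deg s : s \in V -> s != x -> parity (adj F) s.
  move=> sV sx; rewrite -odd_card; apply/negPn/negP => even_s.
  by case/negP: sx; rewrite -in_set1 -evenE inE eqV sV.
have [y] : exists y, y \in [set y | adj F x y].
  by apply/set0Pn; rewrite -card_gt0 lt0n; apply: nonzero.
rewrite inE => Fxy; have xy := EF _ _ Fxy.
pose C := [set v | connect (adj (delete_vertex G x)) y v].
have xNC : x \notin C.
  rewrite inE connect_symm; last exact: adj_sym.
  apply/negP => /leaf_connect eq_yx.
  rewrite eq_yx ?adj_irrefl // in xy.
  by move=> t; rewrite /= /induce_adj !inE eqxx.
have C_closed s t : s \in C -> adj G s t -> t != x -> t \in C.
  move=> sC st tx; have sx : s != x by apply: contraNneq xNC => <-.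
  rewrite inE in sC; rewrite inE; apply: connect_trans sC (connect1 _).
  by rewrite /= /induce_adj !inE sx tx.
have CV : C \subset V.
  apply/subsetP => v; rewrite inE => yv.
  apply: (connect_stable (P := mem V) _ yv); last exact: adj_vertices_r xy.
  by move=> s t /and3P[_ _ st] _; apply: adj_vertices_r st.
have even_C : ~~ odd #|C|.
  by apply: (even_separated (q := x)) => //; rewrite -eqV.
have yC : y \in C by rewrite inE connect0.
(* A second forest neighbour of x in C would close a triangle in an induced
   tree. *)
have only_y z : z \in C -> adj F x z -> z = y.
  move=> zC Fxz; apply/eqP/negPn/negP => zy.
  have yz : adj G y z.
    apply: (@clique_neighbours x) => //; first exact: EF.
      by rewrite inE in zC.
    by rewrite eq_sym.
  have [_ ind] := indF x xF.
  have inX t : adj F x t -> t \in vertices (component F x).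
    move=> xt; rewrite !inE connect1 // andbT.
    by rewrite adj_sym in xt; apply: adj_vertices xt.
  have /and3P[_ _ Fyz] := ind y z (inX y Fxy) (inX z Fxz) yz.
  suff /forestF : ucycle (adj F) [:: x; y; z] by [].
  rewrite /ucycle /= Fxy Fyz adj_sym Fxz !inE negb_or.
  by rewrite (adj_neq xy) (adj_neq yz) (adj_neq (EF _ _ Fxz)).
have: ~~ odd #|x |: C|; last by rewrite cardsU1 xNC /= negbK (negbTE even_C).
apply: (even_card_of_odd (@adj_sym _ F) (@adj_irrefl _ F)) => s /setU1P[->|sC].
  rewrite /is_true -[RHS](parity_pred1 y); apply: eq_bigr => t _.
  apply/andP/eqP => [[/setU1P[->|tC]]|->]; last by rewrite setU1r.
    by rewrite adj_irrefl.
  exact: only_y.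
have sx : s != x by apply: contraNneq xNC => <-.
suff -> : parity (fun s t => (t \in x |: C) && adj F s t) s
            = parity (adj F) s.
  exact: odd_deg (subsetP CV s sC) sx.
apply: eq_parity => t; case: (boolP (adj F s t)) => st; last by rewrite andbF.
rewrite andbT; apply/setU1P; case: (eqVneq t x) => [|tx]; [by left|right].
exact: C_closed sC (EF _ _ st) tx.
Qed.

End OddCompleteBlocks.
End Joins.
End Relations.

Theorem theorem10 (T : finType) (G : sgraph T)
    (Gconn : connected G) (Godd : odd (order_of G)) (Gge3 : 3 <= order_of G) :
  (exists F : sgraph T, proper_one_perfect_forest F G) <->
  ~ odd_complete_blocks G.
Proof.
split=> [[F properF] [_ blocks]|NB].
  exact: no_proper_forest Gconn blocks _ properF.
apply: NNPP => noF; apply: NB.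
apply: isolated_odd_complete_blocks => // x e t nx.
by apply/negP => xt; apply: noF; apply: near_odd_proper nx xt.
Qed.
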